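(* Let $q>0$, $q\ne1$, $N\in\mathbb{Z}_{\ge0}$, $x,y\in\{0,1,\dots,N\}$ and $s,t,v\in\mathbb{C}$. The overlap coefficient $R_{\mathrm r}(x,y)=\langle k_{1,s}(\cdot,x),k_{v,t}(\cdot,y)\rangle_{H_N}$ is a rational function of $q$-Racah type: $$R_{\mathrm r}(x,y)=c_1\;{}_4\varphi_3\!\left(\begin{matrix}q^{-2x},\,-q^{2x+2s-2N},\,-q^{s+t-v+1},\,q^{s-t-v+1}\\ -q^{2s+2},\,q^{-2y+s-t-v+1},\,-q^{2y+s+t-2N-v+1}\end{matrix};q^2,q^2\right),$$ where $$c_1=(-q^{-2N+s+t-v+1};q^2)_N\,\frac{(-q^{-2x-2s};q^2)_x}{(q^{-2N};q^2)_x}\,\frac{(q^{-2y+s-t-v+1};q^2)_y}{(-q^{s+t-2N-v+1};q^2)_y}.$$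
   Context: $(\alpha;p)_n=\prod_{i=0}^{n-1}(1-\alpha p^i)$, $(\alpha_1,\dots,\alpha_m;p)_n=\prod_i(\alpha_i;p)_n$, and $\begin{bmatrix}N\\ n\end{bmatrix}_{p}=\frac{(p;p)_N}{(p;p)_n(p;p)_{N-n}}$. The ${}_4\varphi_3$ with upper parameters $a_1,\dots,a_4$ and lower parameters $b_1,b_2,b_3$ is $\sum_{j\ge0}\frac{(a_1,a_2,a_3,a_4;q^2)_j}{(b_1,b_2,b_3,q^2;q^2)_j}q^{2j}$, which terminates at $j=x$. Renormalized $q^{-1}$-Krawtchouk polynomials: for $n,x\in\{0,\dots,N\}$, $$k_{u,s}(n,x)=(-1)^nq^{n(s-u-\frac12N+\frac12)}\sum_{j=0}^{\min(n,x)}\frac{(q^{2n},\,q^{2x},\,-q^{-2x-2s+2N};q^{-2})_j}{(q^{2N},\,q^{-2};q^{-2})_j}q^{-2j}.$$ $H_N$ is the $(N+1)$-dimensional Hilbert space of functions $f:\{0,1,\dots,N\}\to\mathbb{C}$ with inner product $$\langle f,g\rangle_{H_N}=\sum_{n=0}^Nf(n)\overline{g(n)}\,w(n),\qquad w(n)=q^{n(n-N)}\begin{bmatrix}N\\ n\end{bmatrix}_{q^2}.$$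
   Formalization: The identity as printed is proved for real t, v; for complex t, v, where it fails, it is proved with k_{v,t} replaced by k_{v̄,t̄} in the inner product; the denominators in c_1 and in the ₄φ₃ (through j=x) are assumed nonzero. *)

(* Defs.v *)
From mathcomp Require Import all_boot all_order all_algebra.
From mathcomp Require Import all_classical all_reals all_analysis.
From mathcomp Require Export complex.

Set Implicit Arguments.
Unset Strict Implicit.
Unset Printing Implicit Defensive.

Import Order.TTheory GRing.Theory Num.Theory.
Local Open Scope ring_scope.
Local Open Scope complex_scope.

(* q ^ z := exp (z ln q) with the real logarithm; meaningful for 0 < q only. *)
Definition cpow (R : realType) (q : R) (z : R[i]) : R[i] :=
  (q `^ complex.Re z)%:C *
  (cos (complex.Im z * ln q) +i* sin (complex.Im z * ln q)).

Notation "q `^c z" := (cpow q z)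
  (at level 30, right associativity, format "q  `^c  z") : ring_scope.

Definition qpoch (F : fieldType) (a p : F) (n : nat) : F :=
  \prod_(i < n) (1 - a * p ^+ i).

Definition qpochs (F : fieldType) (s : seq F) (p : F) (n : nat) : F :=
  \prod_(a <- s) qpoch a p n.

Definition qbinom (F : fieldType) (p : F) (N n : nat) : F :=
  qpoch p p N / (qpoch p p n * qpoch p p (N - n)).

Definition bhs_term (F : fieldType) (up lo : seq F) (p z : F) (j : nat) : F :=
  qpochs up p j / qpochs (rcons lo p) p j * z ^+ j.

(* The partial sum over 0 <= j <= m of the basic hypergeometric series
   \sum_(j >= 0) (up; p)_j / (lo, p; p)_j z^j, in the case
   size up = size lo + 1 where the usual extra sign and power of p are absent.
   When p^(-m) is an upper parameter this is the whole series, see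
   bhs_term_eq0. *)
Definition bhs (F : fieldType) (m : nat) (up lo : seq F) (p z : F) : F :=
  \sum_(j < m.+1) bhs_term up lo p z j.

Lemma bhs_term_eq0 (F : fieldType) (m : nat) (up lo : seq F) (p z : F)
    (j : nat) :
  p != 0 -> p ^- m \in up -> (m < j)%N -> bhs_term up lo p z j = 0.
Proof.
move=> p0 pm mj; suff /eqP up0 : qpochs up p j == 0.
  by rewrite /bhs_term up0 !mul0r.
rewrite /qpochs prodf_seq_eq0; apply/hasP; exists (p ^- m) => //=.
rewrite /qpoch prodf_seq_eq0; apply/hasP; exists (Ordinal mj).
  by rewrite mem_index_enum.
by rewrite /= mulVf ?subrr ?expf_neq0.
Qed.

(* The renormalized q^(-1)-Krawtchouk polynomial k_{u,s}(n,x). *)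
Definition krawtchouk (R : realType) (q : R) (N : nat) (u s : R[i])
    (n x : 'I_N.+1) : R[i] :=
  (-1) ^+ n * q `^c (n%:R * (s - u - 2^-1 * N%:R + 2^-1)) *
  \sum_(j < (minn n x).+1)
    qpochs [:: q `^c (2 * n%:R); q `^c (2 * x%:R);
               - q `^c (- 2 * x%:R - 2 * s + 2 * N%:R)] (q `^c (- 2)) j /
    qpochs [:: q `^c (2 * N%:R); q `^c (- 2)] (q `^c (- 2)) j *
    q `^c (- 2 * j%:R).

Definition weight (R : realType) (q : R) (N : nat) (n : 'I_N.+1) : R[i] :=
  q `^c (n%:R * (n%:R - N%:R)) * qbinom (q `^c 2) N n.

Definition inner_HN (R : realType) (q : R) (N : nat)
    (f g : 'I_N.+1 -> R[i]) : R[i] :=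
  \sum_(n < N.+1) f n * (g n)^* * weight q n.

Definition overlap (R : realType) (q : R) (N : nat) (s t v : R[i])
    (x y : 'I_N.+1) : R[i] :=
  inner_HN q (fun n => krawtchouk q 1 s n x) (fun n => krawtchouk q v t n y).

Definition c1 (R : realType) (q : R) (N : nat) (s t v : R[i])
    (x y : 'I_N.+1) : R[i] :=
  qpoch (- q `^c (- 2 * N%:R + s + t - v + 1)) (q `^c 2) N *
  (qpoch (- q `^c (- 2 * x%:R - 2 * s)) (q `^c 2) x /
   qpoch (q `^c (- 2 * N%:R)) (q `^c 2) x) *
  (qpoch (q `^c (- 2 * y%:R + s - t - v + 1)) (q `^c 2) y /
   qpoch (- q `^c (s + t - 2 * N%:R - v + 1)) (q `^c 2) y).

Definition racah_upper (R : realType) (q : R) (N : nat) (s t v : R[i])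
    (x : 'I_N.+1) : seq R[i] :=
  [:: q `^c (- 2 * x%:R); - q `^c (2 * x%:R + 2 * s - 2 * N%:R);
      - q `^c (s + t - v + 1); q `^c (s - t - v + 1)].

Definition racah_lower (R : realType) (q : R) (N : nat) (s t v : R[i])
    (y : 'I_N.+1) : seq R[i] :=
  [:: - q `^c (2 * s + 2); q `^c (- 2 * y%:R + s - t - v + 1);
      - q `^c (2 * y%:R + s + t - 2 * N%:R - v + 1)].

(* Main.v *)
Require Import Defs.
From mathcomp Require Import all_boot all_order all_algebra.
From mathcomp Require Import all_classical all_reals all_analysis.
From mathcomp Require Import ring zify.

Set Implicit Arguments.
Unset Strict Implicit.
Unset Printing Implicit Defensive.

Import Order.TTheory GRing.Theory Num.Theory.
Local Open Scope ring_scope.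
Local Open Scope complex_scope.

(* Write p = q^2, r = p^-1. Put Z = q^(s+t-v-1). All powers of q carried by the
   two Krawtchouk prefactors and the weight combine, and the overlap becomes
     \sum_n [N, n]_r r^C(n,2) Z^n K_x(n) K_y(n),
   where K_x, K_y are series 3phi2(X, r^-x, B; C, 0; r, r) = phi32 r X B C x.
   For a single K_y this sum is a generating function and factors into two
   shifted factorials (krawtchouk_generating). On the other hand K_x(n) is a
   polynomial in p^n whose coefficients are closed products (phi32_phi21, a
   3phi2 -> 2phi1 transformation). Expanding K_x in powers p^(n i) replaces Z by
   Z p^i in the generating function of K_y, and the sum over i is the 4phi3.
   The q-binomial theorem and both q-Chu-Vandermonde sums are instances of
   qbinom_hpoch, a division-free transitivity law for the homogeneous products
   \prod_(i < n) (b - c r^i). *)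

(** For nonzero [b] this is b^n (c/b; p)_n; the homogeneous form also admits [b = 0], where it
    degenerates to a monomial in [c]. *)
Definition hpoch (F : fieldType) (p b c : F) (n : nat) : F :=
  \prod_(i < n) (b - c * p ^+ i).

Definition phi32 (F : fieldType) (r X B C : F) (x : nat) : F :=
  \sum_(j < x.+1) qpoch X r j * qpoch (r ^- x) r j * qpoch B r j /
    (qpoch C r j * qpoch r r j) * r ^+ j.

(** * Homogeneous shifted factorials *)

Section Hpoch.
Variable F : fieldType.
Implicit Types (a b c d p : F) (m n : nat).

Lemma qpochE a p n : qpoch a p n = hpoch p 1 a n.
Proof. by []. Qed.

Lemma hpoch0 p b c : hpoch p b c 0 = 1.
Proof. exact: big_ord0. Qed.

Lemma hpochS p b c n : hpoch p b c n.+1 = hpoch p b c n * (b - c * p ^+ n).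
Proof. exact: big_ord_recr. Qed.

Lemma hpochD p b c m n :
  hpoch p b c (m + n) = hpoch p b c m * hpoch p b (c * p ^+ m) n.
Proof.
elim: n => [|n IHn]; first by rewrite addn0 hpoch0 mulr1.
by rewrite addnS !hpochS IHn exprD -!mulrA.
Qed.

Lemma hpochZ a p b c n : hpoch p (a * b) (a * c) n = a ^+ n * hpoch p b c n.
Proof.
elim: n => [|n IHn]; first by rewrite !hpoch0 mul1r.
by rewrite !hpochS IHn exprS; ring.
Qed.

Lemma binS2 n : 'C(n.+1, 2) = ('C(n, 2) + n)%N.
Proof. by rewrite binS bin1. Qed.

Lemma binD2 m n : 'C(m + n, 2) = ('C(m, 2) + 'C(n, 2) + m * n)%N.
Proof.
elim: n => [|n IHn]; first by rewrite !addn0 muln0 addn0.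
by rewrite addnS !binS2 IHn; lia.
Qed.

Lemma sqr_bin2 n : ('C(n, 2) * 2 + n = n * n)%N.
Proof. by elim: n => // n IHn; rewrite binS2; lia. Qed.

Lemma hpoch0l p c n : hpoch p 0 c n = (- c) ^+ n * p ^+ 'C(n, 2).
Proof.
elim: n => [|n IHn]; first by rewrite hpoch0 mul1r.
by rewrite hpochS IHn binS2 exprD exprS; ring.
Qed.

(** In the reversed product factor i absorbs p^i: p^i (b - c p^(n-1-i)) = -c p^(n-1) + b p^i. The
    value of [n.-1] at [n = 0] is harmless, both products being empty. *)
Lemma hpoch_rev p b c n :
  p ^+ 'C(n, 2) * hpoch p b c n = hpoch p (- c * p ^+ n.-1) (- b) n.
Proof.
case: n => [|n]; first by rewrite !hpoch0 mul1r.
have <- : hpoch p 0 (-1) n.+1 = p ^+ 'C(n.+1, 2).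
  by rewrite hpoch0l opprK expr1n mul1r.
rewrite /hpoch [X in _ * X](reindex_inj rev_ord_inj) -big_split /=.
apply: eq_bigr => i _.
rewrite !subSS; have le_in : (i <= n)%N by rewrite -ltnS.
have -> : p ^+ n = p ^+ (n - i) * p ^+ i by rewrite -exprD subnK.
by ring.
Qed.

Lemma hpoch_inv p b c n : p != 0 ->
  hpoch p^-1 b c n = p^-1 ^+ 'C(n, 2) * hpoch p (- c) (- b) n.
Proof.
move=> p0; elim: n => [|n IHn]; first by rewrite !hpoch0 mul1r.
by rewrite !hpochS IHn binS2 exprD !exprVn; field; rewrite !expf_neq0.
Qed.

Lemma qpoch_inv a p n : p != 0 -> a != 0 ->
  qpoch a p^-1 n = (- a) ^+ n * p^-1 ^+ 'C(n, 2) * qpoch a^-1 p n.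
Proof.
move=> p0 a0; rewrite !qpochE hpoch_inv // mulrAC mulrC.
by rewrite -hpochZ mulr1 mulNr divff.
Qed.

End Hpoch.

Lemma sum_triangle (V : nmodType) (f : nat -> nat -> V) n :
  \sum_(j < n.+1) \sum_(i < j.+1) f j i =
  \sum_(i < n.+1) \sum_(m < (n - i).+1) f (i + m)%N i.
Proof.
elim: n => [|n IHn]; first by rewrite !big_ord1.
rewrite big_ord_recr /= IHn [X in _ + X]big_ord_recr [in RHS]big_ord_recr /=.
rewrite subnn big_ord1 addn0 addrA -big_split; congr (_ + _).
apply: eq_bigr => i _ /=; have le_in : (i <= n)%N by rewrite -ltnS.
by rewrite subSn // [in RHS]big_ord_recr /= addnS subnKC.
Qed.

(** * Summation formulas and generating function in base r *)

Section QSeries.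
Variables (F : fieldType) (r : F).
Hypotheses (r_neq0 : r != 0) (r_exp_neq1 : forall n, r ^+ n.+1 != 1).
Local Notation P n := (qpoch r r n).

Lemma qpoch_self_neq0 n : P n != 0.
Proof.
rewrite /qpoch; apply/prodf_neq0 => i _.
by rewrite subr_eq0 eq_sym -exprS r_exp_neq1.
Qed.
Local Notation P0 := qpoch_self_neq0.

Lemma qpoch_selfS n : P n.+1 = P n * (1 - r ^+ n.+1).
Proof. by rewrite !qpochE hpochS exprS. Qed.

(** Divided by (r; r)_n, the sum is a convolution obeying the same first-order recurrence in n as
    the right-hand side. *)
Lemma qbinom_hpoch b c d n :
  \sum_(k < n.+1) qbinom r n k * hpoch r b c k * hpoch r d b (n - k) =
  hpoch r d c n.
Proof.
pose U k m := hpoch r b c k * hpoch r d b m / (P k * P m).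
suff E : \sum_(k < n.+1) U k (n - k)%N = hpoch r d c n / P n.
  rewrite -[RHS](divfK (P0 n)) -E mulr_suml; apply: eq_bigr => k _.
  by rewrite /U /qbinom; ring.
elim: n => [|n IHn].
  by rewrite big_ord1 /U subn0 !hpoch0 !qpochE !hpoch0 !mulr1.
have d0 : 1 - r ^+ n.+1 != 0 by rewrite subr_eq0 eq_sym.
apply: (mulfI d0).
transitivity (hpoch r d c n / P n * (d - c * r ^+ n)); last first.
  rewrite hpochS qpoch_selfS; field.
  by rewrite P0 d0.
rewrite -IHn mulr_sumr mulr_suml.
(* Splitting 1 - r^(n+1) = (1 - r^(n+1-k)) + r^(n+1-k) (1 - r^k) shortens one product in each sum.
   The released factors d - b r^(n-k) and r^(n-k) (b - c r^k) add up to d - c r^n, which is free of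
   k. *)
transitivity (\sum_(k < n.+2) (1 - r ^+ (n.+1 - k)) * U k (n.+1 - k)%N +
   \sum_(k < n.+2) r ^+ (n.+1 - k) * (1 - r ^+ k) * U k (n.+1 - k)%N).
  rewrite -big_split /=; apply: eq_bigr => k _.
  have le_kn : (k <= n.+1)%N by rewrite -ltnS.
  have -> : r ^+ n.+1 = r ^+ (n.+1 - k) * r ^+ k by rewrite -exprD subnK.
  by ring.
rewrite big_ord_recr [X in _ + X]big_ord_recl /= !subnn expr0 subrr.
rewrite mulr0 !mul0r addr0 add0r -big_split; apply: eq_bigr => k _ /=.
have le_kn : (k <= n)%N by rewrite -ltnS.
rewrite /bump /= add1n subSS subSn // /U !hpochS !qpoch_selfS.
have -> : r ^+ n = r ^+ (n - k) * r ^+ k by rewrite -exprD subnK.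
have := r_exp_neq1 k; have := r_exp_neq1 (n - k).
rewrite eq_sym -subr_eq0 => h1; rewrite eq_sym -subr_eq0 => h2.
by field; rewrite !P0 h1 h2.
Qed.

(** This is [qbinom_hpoch] from 1 to -Z through the middle point 0, where one product becomes a
    monomial and the other becomes 1. *)
Lemma qbinomial_theorem Z n :
  \sum_(k < n.+1) qbinom r n k * r ^+ 'C(k, 2) * Z ^+ k = qpoch (- Z) r n.
Proof.
rewrite qpochE -(qbinom_hpoch 0); apply: eq_bigr => k _.
rewrite hpoch0l opprK.
have -> : hpoch r 1 0 (n - k) = 1.
  by apply: big1 => i _; rewrite mul0r subr0.
by ring.
Qed.

Lemma qpoch_expVn_eq0 n k : (n < k)%N -> qpoch (r ^- n) r k = 0.
Proof.
move=> lt_nk; apply/eqP; rewrite prodf_seq_eq0; apply/hasP.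
exists (Ordinal lt_nk); first by rewrite mem_index_enum.
by rewrite /= mulVf ?subrr ?expf_neq0.
Qed.

Lemma qpoch_expVn n k : (k <= n)%N ->
  qpoch (r ^- n) r k =
  (- r ^- n) ^+ k * r ^+ 'C(k, 2) * (P n / P (n - k)).
Proof.
elim: k => [|k IHk] le_kn.
  by rewrite subn0 !qpochE !hpoch0 !mul1r divff // P0.
rewrite qpochE hpochS -qpochE IHk ?(ltnW le_kn) // binS2 exprD exprS.
rewrite subnS; set m := (n - k)%N; have -> : m = m.-1.+1 by rewrite /m; lia.
rewrite qpoch_selfS /=.
have rm : r ^+ m.-1.+1 = r ^+ n / r ^+ k.
  have -> : n = (m.-1.+1 + k)%N by rewrite /m; lia.
  by rewrite exprD mulfK // expf_neq0.
have h : 1 - r ^+ n / r ^+ k != 0 by rewrite -rm subr_eq0 eq_sym.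
rewrite rm.
have h' : r ^+ k - r ^+ n != 0.
  have: r ^+ k * (1 - r ^+ n / r ^+ k) != 0 by rewrite mulf_neq0 ?expf_neq0.
  by rewrite mulrBr mulr1 mulrC divfK ?expf_neq0.
by field; rewrite P0 h' !expf_neq0.
Qed.

Lemma expr_bin_sub n k : (k <= n)%N ->
  r ^+ 'C(n, 2) * r ^+ 'C(k, 2) * (r / r ^+ n) ^+ k = r ^+ 'C(n - k, 2).
Proof.
move=> le_kn; set m := (n - k)%N.
have -> : n = (m + k)%N by rewrite /m subnK.
rewrite exprMn exprVn -exprM mulrA -!exprD.
(* Clearing the negative power leaves an identity between natural exponents. *)
apply: (@mulIf _ (r ^+ ((m + k) * k))); first by rewrite expf_neq0.
rewrite divfK ?expf_neq0 // -exprD; congr (_ ^+ _).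
by have := sqr_bin2 k; rewrite binD2; lia.
Qed.

(** A q-Chu-Vandermonde sum: reverse the right-hand product, pass through the middle point -1 in
    [qbinom_hpoch], then reverse the product of length n - k back. *)
Lemma qbinom_qpoch_shift b c n :
  \sum_(k < n.+1) qbinom r n k * qpoch b r k * qpoch (c * r ^+ k) r (n - k) *
    ((-1) ^+ k * r ^+ 'C(k, 2) * (r / r ^+ n) ^+ k) =
  hpoch r b c n.
Proof.
apply: (@mulfI _ (r ^+ 'C(n, 2))); first by rewrite expf_neq0.
rewrite hpoch_rev -(qbinom_hpoch (-1)) mulr_sumr; apply: eq_bigr => k _.
have le_kn : (k <= n)%N by rewrite -ltnS.
have -> : hpoch r (-1) (- b) k = (-1) ^+ k * qpoch b r k.
  by rewrite qpochE -hpochZ mulr1 mulN1r.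
have -> : hpoch r (- c * r ^+ n.-1) (-1) (n - k) =
    r ^+ 'C(n - k, 2) * qpoch (c * r ^+ k) r (n - k).
  rewrite qpochE hpoch_rev; have [->|] := posnP (n - k).
    by rewrite !hpoch0.
  move=> h; congr hpoch; rewrite !mulNr -mulrA -exprD.
  by congr (- (c * r ^+ _)); lia.
by rewrite -expr_bin_sub //; ring.
Qed.

(** Expand (X; r)_j in powers of X by the q-binomial theorem. After interchanging the sums, the sum
    over m = j - i is [qbinom_qpoch_shift] with parameters r^i B, r^i C and length x - i. *)
Lemma phi32_expansion X B C x : qpoch C r x != 0 ->
  phi32 r X B C x =
  \sum_(i < x.+1) hpoch r 0 X i * qpoch (r ^- x) r i * qpoch B r i /
     (qpoch C r x * qpoch r r i) * r ^+ i *
     (r ^+ i) ^+ (x - i) * hpoch r B C (x - i).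
Proof.
move=> Cx0; pose f j i := qbinom r j i * hpoch r 0 X i *
  (qpoch (r ^- x) r j * qpoch B r j / (qpoch C r j * P j) * r ^+ j).
transitivity (\sum_(j < x.+1) \sum_(i < j.+1) f j i).
  apply: eq_bigr => j _; rewrite -mulr_suml.
  have -> : \sum_(i < j.+1) qbinom r j i * hpoch r 0 X i = qpoch X r j.
    rewrite qpochE -(qbinom_hpoch 0); apply: eq_bigr => i _.
    rewrite [X in _ = _ * X]big1 ?mulr1 // => l _.
    by rewrite mul0r subr0.
  by ring.
rewrite sum_triangle; apply: eq_bigr => i _.
have le_ix : (i <= x)%N by rewrite -ltnS.
rewrite -!mulrA -hpochZ -(qbinom_qpoch_shift (r ^+ i * B)) !mulr_sumr.
apply: eq_bigr => m _.
have le_mx : (m <= x - i)%N by rewrite -ltnS.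
have Ex : qpoch C r x = qpoch C r i * qpoch (C * r ^+ i) r m *
    qpoch (C * r ^+ i * r ^+ m) r (x - i - m).
  by rewrite !qpochE -mulrA -hpochD subnKC // -hpochD subnKC.
have := Cx0; rewrite Ex !mulf_eq0 !negb_or => /andP[/andP[C1 C2] C3].
rewrite /f /qbinom (mulrC (r ^+ i) C) (mulrC (r ^+ i) B).
have -> : qpoch C r (i + m) = qpoch C r i * qpoch (C * r ^+ i) r m.
  by rewrite !qpochE hpochD.
have -> : qpoch B r (i + m) = qpoch B r i * qpoch (B * r ^+ i) r m.
  by rewrite !qpochE hpochD.
have -> : qpoch (r ^- x) r (i + m) =
    qpoch (r ^- x) r i * qpoch (r ^- (x - i)) r m.
  rewrite !qpochE hpochD; congr (_ * hpoch _ _ _ _).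
  have -> : r ^+ x = r ^+ (x - i) * r ^+ i by rewrite -exprD subnK.
  by rewrite invfM -mulrA mulVf ?mulr1 // expf_neq0.
rewrite [qpoch (r ^- (x - i)) r m]qpoch_expVn // addKn exprD.
rewrite expr_div_n [(- r ^- _) ^+ m]exprNn exprVn.
by field; rewrite !P0 C1 C2 C3 !expf_neq0.
Qed.

(** The factor (r^-n; r)_k kills the terms n < k; with n = k + m the rest is, up to a constant, a
    q-binomial sum of length [M]. *)
Lemma sum_qbinom_qpoch_expVn Z k M :
  \sum_(n < (k + M).+1) qbinom r (k + M) n * r ^+ 'C(n, 2) * Z ^+ n *
     qpoch (r ^- n) r k =
  qpoch (r ^- (k + M)) r k * Z ^+ k * r ^+ 'C(k, 2) * (r ^+ M) ^+ k *
  qpoch (- Z) r M.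
Proof.
rewrite -addnS big_split_ord /= big1 ?add0r; last first.
  by move=> n _; rewrite qpoch_expVn_eq0 // mulr0.
rewrite -qbinomial_theorem mulr_sumr; apply: eq_bigr => m _ /=.
rewrite !qpoch_expVn ?leq_addr // !addKn /qbinom subnDl binD2 !exprD.
have -> : r ^+ (k * m) = (r ^+ m) ^+ k by rewrite -exprM mulnC.
rewrite !invfM ![(- (_ * _)) ^+ k]exprNn !exprMn !exprVn.
have nz a b : r ^+ a ^+ b != 0 by do 2!apply: expf_neq0.
by field; rewrite !P0 !nz.
Qed.

Lemma krawtchouk_generating Z B N y : (y <= N)%N ->
  \sum_(n < N.+1) qbinom r N n * r ^+ 'C(n, 2) * Z ^+ n *
    phi32 r (r ^- n) B (r ^- N) y =
  qpoch (- Z) r (N - y) * qpoch (- Z * r ^+ (N - y) * B) r y.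
Proof.
(* With this [b], (-Z; r)_(N-k) = (-Z; r)_(N-y) (b; r)_(y-k) for k at most y, so the sum over k is
   [qbinom_hpoch] from 1 to [b * B] through [b]. *)
move=> le_yN; set b := - Z * r ^+ (N - y).
rewrite [X in _ * X]qpochE -(qbinom_hpoch b) mulr_sumr.
under eq_bigr do rewrite mulr_sumr.
rewrite exchange_big /=; apply: eq_bigr => k _.
have le_ky : (k <= y)%N by rewrite -ltnS.
have [M defN] : exists M, N = (k + M)%N.
  by exists (N - k)%N; rewrite subnKC // (leq_trans le_ky).
have Nk0 : qpoch (r ^- N) r k != 0.
  rewrite qpoch_expVn ?(leq_trans le_ky) // !mulf_neq0 ?invr_eq0 ?P0 //.
    by rewrite expf_neq0 // oppr_eq0 invr_eq0 expf_neq0.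
  by rewrite expf_neq0.
transitivity ((\sum_(n < N.+1) qbinom r N n * r ^+ 'C(n, 2) * Z ^+ n *
     qpoch (r ^- n) r k) *
   (qpoch (r ^- y) r k * qpoch B r k / (qpoch (r ^- N) r k * P k) * r ^+ k)).
  by rewrite mulr_suml; apply: eq_bigr => n _; ring.
rewrite defN sum_qbinom_qpoch_expVn -defN.
have -> : qpoch (- Z) r M = qpoch (- Z) r (N - y) * qpoch b r (y - k).
  by rewrite !qpochE -hpochD; congr hpoch; lia.
have -> : hpoch r b (b * B) k = b ^+ k * qpoch B r k.
  by rewrite -hpochZ mulr1.
rewrite [qpoch (r ^- y) r k]qpoch_expVn // -[hpoch r 1 b _]qpochE /qbinom.
(* Since N = k + M, the exponent Mk + k + 2 C(k,2) equals Nk, and r^(-yk) lowers it to (N - y)k. *)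
have E : Z ^+ k * r ^+ 'C(k, 2) * (r ^+ M) ^+ k * r ^+ k *
    ((- r ^- y) ^+ k * r ^+ 'C(k, 2)) = b ^+ k.
  rewrite /b mulNr [(- r ^- y) ^+ k]exprNn [(- (_ * _)) ^+ k]exprNn.
  rewrite !exprMn exprVn -!exprM.
  have nz : r ^+ (y * k) != 0 by rewrite expf_neq0.
  have Er : r ^+ (M * k) * r ^+ k * r ^+ 'C(k, 2) * r ^+ 'C(k, 2) =
      r ^+ ((N - y) * k) * r ^+ (y * k).
    rewrite -!exprD -mulnDl subnK // defN mulnDl; congr (_ ^+ _).
    by have := sqr_bin2 k; lia.
  apply: (mulIf nz).
  transitivity ((-1) ^+ k * Z ^+ k * (r ^+ ((N - y) * k) * r ^+ (y * k))).
    by rewrite -Er; field.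
  by ring.
rewrite -E; field.
by rewrite !P0 Nk0.
Qed.

End QSeries.

(** * Inversion of the base and the overlap sum as a 4phi3 *)

Section Overlap.
Variables (F : fieldType) (p : F).
Hypotheses (p_neq0 : p != 0) (p_exp_neq1 : forall n, p ^+ n.+1 != 1).
Local Notation r := (p^-1).

Let r_neq0 : r != 0.
Proof. by rewrite invr_eq0. Qed.

Let r_exp_neq1 n : r ^+ n.+1 != 1.
Proof. by rewrite exprVn invr_eq1. Qed.

Lemma qpoch_rev a n : qpoch (a * p ^+ n) r n = qpoch (a * p) p n.
Proof.
rewrite /qpoch [RHS](reindex_inj rev_ord_inj); apply: eq_bigr => i _ /=.
have -> : p ^+ n = p ^+ (n - i.+1) * p * p ^+ i.
  by rewrite -exprSr -exprD -subSn // subSS subnK // ltnW.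
by rewrite exprVn; congr (1 - _); field; rewrite expf_neq0.
Qed.

(** Both sides are (a; p)_(m+n). The use is to move a summation index from a parameter into a
    length. *)
Lemma qpoch_shift a m n :
  qpoch (a * p ^+ m) p n * qpoch a p m = qpoch a p n * qpoch (a * p ^+ n) p m.
Proof. by rewrite !qpochE mulrC -!hpochD addnC. Qed.

Lemma qpoch_neq0_le a m n : (m <= n)%N -> qpoch a p n != 0 -> qpoch a p m != 0.
Proof.
move=> le_mn; rewrite -(subnKC le_mn) !qpochE hpochD mulf_eq0.
by case/norP.
Qed.

Lemma qbinomV N n : (n <= N)%N ->
  qbinom p N n = qbinom r N n * p ^+ n ^+ (N - n).
Proof.
move=> le_nN; set m := (N - n)%N.
have defN : N = (n + m)%N by rewrite /m subnKC.
have Q0 := qpoch_self_neq0 p_exp_neq1.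
rewrite /qbinom -/m !(@qpoch_inv _ r p) // invrK [in (- r) ^+ N]defN.
rewrite [in r ^+ 'C(N, 2)]defN binD2 !exprD exprM !exprVn.
by field; rewrite !Q0 !expf_neq0 // oppr_eq0 invr_eq0.
Qed.

(** This is [phi32_expansion] with every factorial moved to base p. Only X^i depends on X, so X =
    p^n gives a polynomial in p^n. *)
Lemma phi32_phi21 X B C x :
    B != 0 -> C != 0 -> qpoch C r x != 0 ->
    qpoch (p * C / (p ^+ x * B)) p x != 0 ->
  phi32 r X B C x =
  qpoch (B / C) p x / qpoch C^-1 p x *
  \sum_(i < x.+1) qpoch (p ^- x) p i * qpoch B^-1 p i /
    (qpoch (p * C / (p ^+ x * B)) p i * qpoch p p i) * p ^+ i * X ^+ i.
Proof.
move=> B0 C0 Cx0 g0; rewrite phi32_expansion // mulr_sumr.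
apply: eq_bigr => i _; have le_ix : (i <= x)%N by rewrite -ltnS.
have Cx0' : qpoch C^-1 p x != 0.
  by move: Cx0; rewrite qpoch_inv // mulf_eq0 => /norP[].
set g := p * C / (p ^+ x * B) in g0 *.
have gi0 := qpoch_neq0_le le_ix g0.
set e := (x - i)%N; have defx : x = (e + i)%N by rewrite /e subnK.
have -> : r ^- x = p ^+ x by rewrite exprVn invrK.
rewrite hpoch0l !(@qpoch_inv _ _ p) // ?expf_neq0 // invrK.
have -> : hpoch r B C e = (- C) ^+ e * r ^+ 'C(e, 2) * qpoch (B / C) p e.
  rewrite hpoch_inv // mulrAC mulrC; congr (_ * _).
  by rewrite qpochE -hpochZ mulr1; congr hpoch; field.
(* Since 1/g = (B/C) p^(x-1), the last i factors of (B/C; p)_x read backwards form (g; p)_i up to a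
   monomial; this produces the lower parameter [g]. *)
have -> : qpoch (B / C) p x = qpoch (B / C) p e *
    ((- g^-1) ^+ i * r ^+ 'C(i, 2) * qpoch g p i).
  rewrite [in LHS]defx !qpochE hpochD -!qpochE; congr (_ * _).
  apply: (@mulfI _ (p ^+ 'C(i, 2))); first by rewrite expf_neq0.
  rewrite qpochE hpoch_rev.
  have -> : hpoch p (- (B / C * p ^+ e) * p ^+ i.-1) (-1) i =
      hpoch p (- g^-1 * 1) (- g^-1 * g) i.
    have [->|i_gt0] := posnP i; first by rewrite !hpoch0.
    have -> : - g^-1 * g = -1.
      rewrite mulNr mulVf // /g mulf_neq0 ?invr_eq0 ?mulf_neq0 //.
      by rewrite expf_neq0.
    congr hpoch; rewrite mulr1.
    have -> : g^-1 = B / C * p ^+ x / p.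
      by rewrite /g; field; rewrite p_neq0 C0 B0 expf_neq0.
    have -> : p ^+ x = p ^+ e * p ^+ i.-1 * p.
      by rewrite -exprD -exprSr; congr (_ ^+ _); lia.
    by field; rewrite p_neq0 C0.
  by rewrite hpochZ -qpochE exprVn; field; rewrite expf_neq0.
have binx : 'C(x, 2) = ('C(i, 2) + 'C(e, 2) + i * e)%N.
  by rewrite [in LHS]defx addnC binD2.
have qi0 := qpoch_self_neq0 p_exp_neq1 i.
rewrite binx !exprD.
have -> : r ^+ (i * e) = r ^+ i ^+ e by rewrite exprM.
have -> : (- C) ^+ x = (- C) ^+ e * (- C) ^+ i by rewrite -exprD -defx.
have gE : - g^-1 = (- 1) * (p ^+ x * B / (p * C)).
  by rewrite /g; field; rewrite p_neq0 C0 B0 expf_neq0.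
rewrite (exprNn X) (exprNn (p ^+ x)) (exprNn B) (exprNn C i) (exprNn r) gE.
rewrite !exprMn !exprVn exprMn.
have nz (a : F) n : a != 0 -> a ^+ n != 0 by exact: expf_neq0.
field.
by rewrite qi0 Cx0' gi0 !nz ?oppr_eq0 ?oner_eq0.
Qed.

Lemma overlap_phi43 N x y A B z :
    (x <= N)%N -> (y <= N)%N -> A != 0 -> B != 0 ->
    qpoch (p * p ^+ N / (p ^+ x * B)) p x != 0 ->
    qpoch (- z * A) p x != 0 -> qpoch (- z * p ^+ y) p x != 0 ->
    qpoch (- z) p y != 0 ->
  \sum_(n < N.+1) qbinom r N n * r ^+ 'C(n, 2) * (z * p ^+ N / p) ^+ n *
    (phi32 r (p ^+ n) B (p ^+ N) x * phi32 r (p ^+ n) A (p ^+ N) y) =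
  qpoch (- z) p N * (qpoch (B / p ^+ N) p x / qpoch (p ^- N) p x) *
  (qpoch (- z * A) p y / qpoch (- z) p y) *
  \sum_(i < x.+1)
    (qpoch (p ^- x) p i * qpoch B^-1 p i * qpoch (- z * p ^+ N) p i *
     qpoch (- z * A * p ^+ y) p i) /
    (qpoch (p * p ^+ N / (p ^+ x * B)) p i * qpoch (- z * A) p i *
     qpoch (- z * p ^+ y) p i * qpoch p p i) * p ^+ i.
Proof.
move=> le_xN le_yN A0 B0 g0 zA0 zy0 z0.
have CN0 : qpoch (p ^+ N) r x != 0.
  have -> : p ^+ N = r ^- N by rewrite exprVn invrK.
  rewrite qpoch_expVn // !mulf_neq0 ?invr_eq0 //.
  - by rewrite expf_neq0 // oppr_eq0 invr_eq0 expf_neq0.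
  - by rewrite expf_neq0.
  - exact: qpoch_self_neq0.
  - exact: qpoch_self_neq0.
under eq_bigr do rewrite phi32_phi21 ?expf_neq0 //.
set pre := qpoch (B / p ^+ N) p x / _.
pose d i := qpoch (p ^- x) p i * qpoch B^-1 p i /
    (qpoch (p * p ^+ N / (p ^+ x * B)) p i * qpoch p p i) * p ^+ i.
(* Only the factor at [x] is expanded; its power p^(ni) merges into the n-th power, and p^n = r^-n
   puts the factor at [y] in the form of the generating function. *)
transitivity (pre * \sum_(i < x.+1) d i *
   \sum_(n < N.+1) qbinom r N n * r ^+ 'C(n, 2) *
     (z * p ^+ N / p * p ^+ i) ^+ n * phi32 r (r ^- n) A (r ^- N) y).
  under [in RHS]eq_bigr do rewrite mulr_sumr.
  rewrite exchange_big mulr_sumr; apply: eq_bigr => n _ /=.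
  rewrite -(mulrA pre) mulrCA mulr_suml mulr_sumr; congr (_ * _).
  apply: eq_bigr => i _.
  have rV m : r ^- m = p ^+ m by rewrite exprVn invrK.
  have -> : p ^+ n ^+ i = p ^+ i ^+ n by rewrite -!exprM mulnC.
  by rewrite !rV [(_ * p ^+ i) ^+ n]exprMn /d; ring.
rewrite (mulrC (qpoch (- z) p N)) -!(mulrA pre); congr (pre * _).
rewrite mulr_sumr.
apply: eq_bigr => i _; have le_ix : (i <= x)%N by rewrite -ltnS.
rewrite krawtchouk_generating //.
have pN : p ^+ N = p ^+ (N - y) * p ^+ y by rewrite -exprD subnK.
have -> : qpoch (- (z * p ^+ N / p * p ^+ i)) r (N - y) =
    qpoch (- z * p ^+ y * p ^+ i) p (N - y).
  have -> : - (z * p ^+ N / p * p ^+ i) =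
      - z * p ^+ y * p ^+ i / p * p ^+ (N - y).
    by rewrite pN; ring.
  by rewrite qpoch_rev divfK.
have -> : qpoch (- (z * p ^+ N / p * p ^+ i) * r ^+ (N - y) * A) r y =
    qpoch (- z * A * p ^+ i) p y.
  have -> : - (z * p ^+ N / p * p ^+ i) * r ^+ (N - y) * A =
      - z * A * p ^+ i / p * p ^+ y.
    by rewrite pN exprVn; field; rewrite p_neq0 expf_neq0.
  by rewrite qpoch_rev divfK.
have zAi0 := qpoch_neq0_le le_ix zA0; have zyi0 := qpoch_neq0_le le_ix zy0.
have gi0 := qpoch_neq0_le le_ix g0.
(* Both factorials become an i-free factor times a ratio of factorials of length i, the latter being
   the 4phi3 parameters. *)
have -> : qpoch (- z * p ^+ y * p ^+ i) p (N - y) =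
    qpoch (- z * p ^+ y) p (N - y) * qpoch (- z * p ^+ N) p i /
    qpoch (- z * p ^+ y) p i.
  apply: (canRL (mulfK zyi0)); rewrite qpoch_shift.
  by congr (_ * qpoch _ _ _); rewrite pN; ring.
have -> : qpoch (- z * A * p ^+ i) p y =
    qpoch (- z * A) p y * qpoch (- z * A * p ^+ y) p i / qpoch (- z * A) p i.
  by apply: (canRL (mulfK zAi0)); rewrite qpoch_shift.
have -> : qpoch (- z) p N = qpoch (- z) p y * qpoch (- z * p ^+ y) p (N - y).
  by rewrite !qpochE -hpochD subnKC.
rewrite /d; field.
by rewrite z0 zAi0 zyi0 gi0 qpoch_self_neq0.
Qed.

End Overlap.

(** * Complex powers of q and the Krawtchouk polynomials as 3phi2 *)

Section Cpow.
Variables (R : realType) (q : R).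
Hypothesis q_gt0 : 0 < q.
Implicit Types (a b : R[i]) (n : nat).

Lemma cpowD a b : q `^c (a + b) = q `^c a * q `^c b.
Proof.
case: a b => [a1 a2] [b1 b2]; rewrite /cpow /= powRD; last first.
  by rewrite (gt_eqF q_gt0) implybT.
rewrite mulrDl cosD sinD; apply/eqP; rewrite eq_complex /=.
by apply/andP; split; apply/eqP; ring.
Qed.

Lemma cpow0 : q `^c 0 = 1.
Proof. by rewrite /cpow /= powRr0 mul0r cos0 sin0 mul1r. Qed.

Lemma cpow_neq0 a : q `^c a != 0.
Proof.
apply/eqP => a0; have := cpowD a (- a).
by rewrite a0 mul0r subrr cpow0 => /eqP; rewrite oner_eq0.
Qed.

Lemma cpowN a : q `^c (- a) = (q `^c a)^-1.
Proof.
apply: (mulfI (cpow_neq0 a)).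
by rewrite -cpowD subrr cpow0 divff ?cpow_neq0.
Qed.

Lemma cpowM_nat n a : q `^c (n%:R * a) = (q `^c a) ^+ n.
Proof.
elim: n => [|n IHn]; first by rewrite mul0r cpow0.
by rewrite -natr1 mulrDl mul1r cpowD IHn exprSr.
Qed.

Lemma cpow_conj a : conjc (q `^c a) = q `^c (conjc a).
Proof.
by case: a => a1 a2; rewrite /cpow rmorphM /= oppr0 mulNr cosN sinN.
Qed.

Lemma cpow2 : q `^c 2 = (q ^+ 2)%:C.
Proof.
rewrite -[2 in LHS]mulr1 cpowM_nat rmorphXn; congr (_ ^+ 2).
by rewrite /cpow /= powRr1 ?ltW // mul0r cos0 sin0 mulr1.
Qed.

Lemma cpow2_exp_neq1 n : q != 1 -> (q `^c 2) ^+ n.+1 != 1.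
Proof.
move=> q1; rewrite cpow2 -rmorphXn -exprM.
apply: contra_neq q1 => /complexI.
by move=> /eqP; rewrite pexpr_eq1 ?ltW // => /eqP.
Qed.

(** The range up to min(n, x) extends to x because p^n = r^-n makes (p^n; r)_j vanish for j > n. *)
Lemma krawtchoukE N u s (n x : 'I_N.+1) :
  krawtchouk q u s n x =
  (- q `^c (s - u - 2^-1 * N%:R + 2^-1)) ^+ n *
  phi32 (q `^c 2)^-1 ((q `^c 2) ^+ n) (- q `^c (- 2 * x%:R - 2 * s + 2 * N%:R))
    ((q `^c 2) ^+ N) x.
Proof.
have E2 m : q `^c (2 * m%:R) = (q `^c 2) ^+ m by rewrite mulrC cpowM_nat.
have E2N m : q `^c (- 2 * m%:R) = (q `^c 2)^-1 ^+ m.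
  by rewrite mulNr cpowN E2 exprVn.
have r0 : (q `^c 2)^-1 != 0 by rewrite invr_eq0 cpow_neq0.
rewrite /krawtchouk cpowM_nat -exprNn; congr (_ * _).
have -> : q `^c (-2) = (q `^c 2)^-1 by rewrite cpowN.
rewrite /phi32 [RHS](bigID (fun j : 'I_x.+1 => (j <= n)%N)) /=.
rewrite [X in _ = _ + X]big1 ?addr0; last first.
  move=> j; rewrite -ltnNge => lt_nj.
  have -> : (q `^c 2) ^+ n = (q `^c 2)^-1 ^- n by rewrite exprVn invrK.
  by rewrite (qpoch_expVn_eq0 r0 lt_nj) !mul0r.
have le_m : ((minn n x).+1 <= x.+1)%N by rewrite ltnS geq_minr.
pose f j := qpoch (q `^c (2 * n%:R)) (q `^c 2)^-1 j *
  qpoch (q `^c (2 * x%:R)) (q `^c 2)^-1 j *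
  qpoch (- q `^c (- 2 * x%:R - 2 * s + 2 * N%:R)) (q `^c 2)^-1 j /
  (qpoch (q `^c (2 * N%:R)) (q `^c 2)^-1 j *
   qpoch (q `^c 2)^-1 (q `^c 2)^-1 j) * (q `^c 2)^-1 ^+ j.
transitivity (\sum_(j < (minn n x).+1) f j).
  apply: eq_bigr => j _.
  rewrite /qpochs !big_cons !big_nil !mulr1 E2N.
  by rewrite /f !mulrA.
rewrite (big_ord_widen _ f le_m); apply: eq_big => [j|j _].
  by rewrite ltnS leq_min -(ltnS j x) ltn_ord andbT.
have -> : (q `^c 2)^-1 ^- x = (q `^c 2) ^+ x by rewrite exprVn invrK.
by rewrite /f !E2.
Qed.

(** Meant for complex conjugation, which commutes with powers of the positive real q by
    [cpow_conj]. *)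
Lemma krawtchouk_rmorph (f : {rmorphism R[i] -> R[i]}) N u s (n x : 'I_N.+1) :
    {morph f : a / q `^c a} ->
  f (krawtchouk q u s n x) = krawtchouk q (f u) (f s) n x.
Proof.
have qpochJ a p m : f (qpoch a p m) = qpoch (f a) (f p) m.
  rewrite /qpoch rmorph_prod; apply: eq_bigr => i _.
  by rewrite rmorphB rmorph1 rmorphM rmorphXn.
(* Generalizing cpow q keeps rmorphM from unfolding it as a product. *)
rewrite /krawtchouk; move: (cpow q) => c cJ.
rewrite !rmorphM rmorph_sum rmorphXn rmorphN1 cJ.
congr (_ * c _ * _).
  by rewrite rmorphM rmorphD !rmorphB rmorphM !fmorphV !rmorph_nat.
apply: eq_bigr => j _.
rewrite rmorphM fmorph_div /qpochs !big_cons !big_nil !rmorphM !qpochJ !rmorph1.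
rewrite rmorphN !cJ rmorphD rmorphB !rmorphM !rmorphN !rmorph_nat.
by [].
Qed.

End Cpow.

(** * The Krawtchouk overlap in q-Racah form *)

Section KrawtchoukOverlap.
Variables (R : realType) (q : R) (N : nat).
Hypotheses (q_gt0 : 0 < q) (q_neq1 : q != 1).
Local Notation p := (q `^c 2).

Lemma krawtchouk_weight (s t v : R[i]) (n x y : 'I_N.+1) :
  krawtchouk q 1 s n x * krawtchouk q v t n y * weight q n =
  qbinom p^-1 N n * p^-1 ^+ 'C(n, 2) *
    (q `^c (- 2 * N%:R + s + t - v + 1) * p ^+ N / p) ^+ n *
  (phi32 p^-1 (p ^+ n) (- q `^c (- 2 * x%:R - 2 * s + 2 * N%:R)) (p ^+ N) x *
   phi32 p^-1 (p ^+ n) (- q `^c (- 2 * y%:R - 2 * t + 2 * N%:R)) (p ^+ N) y).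
Proof.
have le_nN : (n <= N)%N by rewrite -ltnS.
have p0 : p != 0 by rewrite cpow_neq0.
have p1 m : p ^+ m.+1 != 1 by rewrite cpow2_exp_neq1.
rewrite !krawtchoukE // /weight (qbinomV p0 p1 le_nN).
(* The last power on the left comes from inverting the base of the q-binomial. The signs cancel, and
   both sides equal q^(n(s+t-v) - n^2). *)
suff M : (- q `^c (s - 1 - 2^-1 * N%:R + 2^-1)) ^+ n *
    (- q `^c (t - v - 2^-1 * N%:R + 2^-1)) ^+ n *
    q `^c (n%:R * (n%:R - N%:R)) * p ^+ n ^+ (N - n) =
    p^-1 ^+ 'C(n, 2) *
    (q `^c (- 2 * N%:R + s + t - v + 1) * p ^+ N / p) ^+ n.
  by rewrite -[qbinom _ _ _ * _ * _]mulrA -M; ring.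
rewrite -exprMn mulrNN -cpowN // -!cpowM_nat // -!cpowD // -!cpowM_nat //.
rewrite -!cpowD // natrB //.
have := congr1 (fun m : nat => m%:R : R[i]) (sqr_bin2 n).
rewrite natrD !natrM => C2.
have -> : 'C(n, 2)%:R * - 2 = n%:R - n%:R * n%:R :> R[i].
  by rewrite -C2; ring.
by congr cpow; field.
Qed.

Lemma sum_krawtchouk (s t v : R[i]) (x y : 'I_N.+1) :
    qpochs (racah_lower q s t v y) p x != 0 ->
    qpoch (- q `^c (s + t - 2 * N%:R - v + 1)) p y != 0 ->
  \sum_(n < N.+1) krawtchouk q 1 s n x * krawtchouk q v t n y * weight q n =
  c1 q s t v x y * bhs x (racah_upper q s t v x) (racah_lower q s t v y) p p.
Proof.
have p0 : p != 0 by rewrite cpow_neq0.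
have p1 m : p ^+ m.+1 != 1 by rewrite cpow2_exp_neq1.
under eq_bigr do rewrite krawtchouk_weight.
set z := q `^c (- 2 * N%:R + s + t - v + 1).
set B := - q `^c (- 2 * x%:R - 2 * s + 2 * N%:R).
set A := - q `^c (- 2 * y%:R - 2 * t + 2 * N%:R).
rewrite /racah_lower /racah_upper /c1 /bhs /bhs_term /qpochs /=.
have pX m : p ^+ m = q `^c (2 * m%:R) by rewrite -cpowM_nat // mulrC.
pose cpowE := (=^~ cpowD q_gt0, =^~ cpowN q_gt0).
pose signE := (mulrN, mulNr, invrN, opprK).
(* Dictionary turning every parameter of the 4phi3 and of [c1] into a monomial in z, A, B and p. *)
have -> : - q `^c (2 * s + 2) = p * p ^+ N / (p ^+ x * B).
  by rewrite /z /A /B ?pX ?signE ?cpowE; congr (- cpow _ _); ring.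
have -> : q `^c (- 2 * y%:R + s - t - v + 1) = - z * A.
  by rewrite /z /A /B ?pX ?signE ?cpowE; congr cpow; ring.
have -> : - q `^c (2 * y%:R + s + t - 2 * N%:R - v + 1) = - z * p ^+ y.
  by rewrite /z /A /B ?pX ?signE ?cpowE; congr (- cpow _ _); ring.
have -> : - q `^c (s + t - 2 * N%:R - v + 1) = - z.
  by rewrite /z /A /B ?pX ?signE ?cpowE; congr (- cpow _ _); ring.
have -> : - q `^c (- 2 * x%:R - 2 * s) = B / p ^+ N.
  by rewrite /z /A /B ?pX ?signE ?cpowE; congr (- cpow _ _); ring.
have -> : q `^c (- 2 * N%:R) = p ^- N.
  by rewrite /z /A /B ?pX ?signE ?cpowE; congr cpow; ring.
have -> : q `^c (- 2 * x%:R) = p ^- x.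
  by rewrite /z /A /B ?pX ?signE ?cpowE; congr cpow; ring.
have -> : - q `^c (2 * x%:R + 2 * s - 2 * N%:R) = B^-1.
  by rewrite /z /A /B ?pX ?signE ?cpowE; congr (- cpow _ _); ring.
have -> : - q `^c (s + t - v + 1) = - z * p ^+ N.
  by rewrite /z /A /B ?pX ?signE ?cpowE; congr (- cpow _ _); ring.
have -> : q `^c (s - t - v + 1) = - z * A * p ^+ y.
  by rewrite /z /A /B ?pX ?signE ?cpowE; congr cpow; ring.
rewrite !big_cons big_nil mulr1 !mulf_eq0 !negb_or => /and3P[g0 zA0 zy0] z0.
rewrite overlap_phi43 //; try by [rewrite -ltnS | rewrite oppr_eq0 cpow_neq0].
congr (_ * _); apply: eq_bigr => i _.
by rewrite !big_cons !big_nil !mulr1 !mulrA.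
Qed.

End KrawtchoukOverlap.

(* The two nonvanishing hypotheses say exactly that the right-hand side has no
   zero denominator; the other denominators never vanish. *)
Theorem proposition3p2 (R : realType) (q : R) (N : nat) (x y : 'I_N.+1)
    (s t v : R[i])
    (q_gt0 : 0 < q) (q_neq1 : q != 1)
    (phi_def : qpochs (racah_lower q s t v y) (q `^c 2) x != 0)
    (c1_def :
       qpoch (- q `^c (s + t - 2 * N%:R - v + 1)) (q `^c 2) y != 0) :
  (t^* = t -> v^* = v ->
     overlap q s t v x y =
     c1 q s t v x y *
     bhs x (racah_upper q s t v x) (racah_lower q s t v y)
       (q `^c 2) (q `^c 2)) /\
  overlap q s t^* v^* x y =
  c1 q s t v x y *
  bhs x (racah_upper q s t v x) (racah_lower q s t v y)
    (q `^c 2) (q `^c 2).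
Proof.
(* The conjugated identity suffices: real t and v are fixed by conjugation. *)
suff E : overlap q s t^* v^* x y = c1 q s t v x y *
    bhs x (racah_upper q s t v x) (racah_lower q s t v y) (q `^c 2) (q `^c 2).
  by split=> // tJ vJ; rewrite -[in LHS]tJ -[in LHS]vJ.
rewrite -sum_krawtchouk // /overlap /inner_HN.
apply: eq_bigr => n _; congr (_ * _ * _).
(* The conjugate in the inner product undoes those on v and t, leaving the bilinear sum of
   [sum_krawtchouk]. *)
pose J : {rmorphism R[i] -> R[i]} := @conjc R.
have := @krawtchouk_rmorph R q J N v^* t^* n y (@cpow_conj R q).
by rewrite /J /= !conjcK.
Qed.
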